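(* Let $\mathcal{F}_1,\ldots,\mathcal{F}_n$ be finite families of convex subsets of $\mathbb{R}^d$. If $\bigcap\mathcal{F}_i=\emptyset$ for all $i\in[n]$ and $n\ge d+2$, then $\mathbf{RG}_{\mathrm{CH}}(\mathcal{F}_1,\ldots,\mathcal{F}_n)$ is connected.
   Context: $\mathbf{RG}_{\mathrm{CH}}(\mathcal{F}_1,\ldots,\mathcal{F}_n)$ is the graph whose vertices are the ordered tuples $(C_1,\ldots,C_n)$ with $C_i\in\mathcal{F}_i$ for all $i$ and $\bigcap_{i=1}^n C_i=\emptyset$; two tuples $(C_1,\ldots,C_n)$ and $(D_1,\ldots,D_n)$ are adjacent if there is a unique index $j$ with $C_j\neq D_j$ and moreover $\bigcap_{i\neq j}C_i=\emptyset$. *)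

(* Defs.v *)
From HB Require Import structures.
From mathcomp Require Import all_boot all_order all_algebra.
From mathcomp Require Import all_classical all_reals.
From mathcomp Require Import convex.
From Stdlib Require Import Relations.
Set Implicit Arguments. Unset Strict Implicit. Unset Printing Implicit Defensive.
Import Order.TTheory GRing.Theory Num.Theory.
Local Open Scope classical_set_scope.
Local Open Scope ring_scope.

Section RG.
Variables (R : realType) (d n : nat).
Notation pt := 'rV[R]_d.

Definition convex_subset (C : set pt) : Prop :=
  @convex_set R pt (C : set (convex_lmodType pt)).

Definition RG_vertex (F : 'I_n -> set (set pt)) (C : 'I_n -> set pt) : Prop :=
  (forall i, F i (C i)) /\ \bigcap_i C i = set0.

Definition RG_adj (C D : 'I_n -> set pt) : Prop :=
  exists j : 'I_n,
    C j <> D j /\ (forall i, i <> j -> C i = D i) /\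
    \bigcap_(i in [set~ j]) C i = set0.

Definition RG_edge (F : 'I_n -> set (set pt)) (C D : 'I_n -> set pt) : Prop :=
  RG_vertex F C /\ RG_vertex F D /\ RG_adj C D.

Definition RG_connected (F : 'I_n -> set (set pt)) : Prop :=
  forall C D, RG_vertex F C -> RG_vertex F D ->
    clos_refl_trans _ (RG_edge F) C D.
End RG.

(* Main.v *)
(* Sweep R^d by balls growing around the origin.  Replace the sets by closed
   polyhedra with the same intersection pattern and such that no point lies on the
   boundary of more than d of them.  The intersection of a family then has a point
   of least norm, and the at most d sets having it on their boundary already
   determine it.

   At level k keep only the tuples, and the single-coordinate moves, whose
   intersection has no point of rank below k.  At level 0 every move is allowed, at
   the last level one has the reconfiguration graph.  When passing from k to k + 1,
   a path meets tuples whose least-norm point x has rank exactly k.  At most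
   d <= n - 2 of its sets are tight at x, and every F_i contains a set missing x;
   putting such a set in a non-tight coordinate lifts the tuple to level k + 1, and
   the two spare coordinates connect the lifts of adjacent tuples. *)
Require Import Defs.
From mathcomp Require Import all_boot all_order all_algebra.
From mathcomp Require Import all_classical all_reals.
From mathcomp Require Import convex.
From mathcomp Require Import topology normedtype derive interval_inference ring lra.
From Stdlib Require Import Relations.
Set Implicit Arguments. Unset Strict Implicit. Unset Printing Implicit Defensive.
Import Order.TTheory GRing.Theory Num.Theory numFieldNormedType.Exports.
Local Open Scope classical_set_scope.
Local Open Scope ring_scope.

(** * Gordan's alternative, from the nearest point of a polytope *)

Lemma continuous_sum (R : numFieldType) (T : topologicalType) (I : Type)
    (r : seq I) (P : pred I) (f : I -> T -> R) :
  (forall i, continuous (f i)) ->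
  continuous (fun x => \sum_(i <- r | P i) f i x).
Proof.
move=> cf x; apply: (cvg_big (x0 := 0 : R)) => [|i _]; last exact: cf.
exact: add_continuous.
Qed.

Lemma min_of_quadratic_ge0 (R : realFieldType) (a b : R) :
  (forall t, 0 < t -> t <= 1 -> 0 <= t * a + t ^+ 2 * b) -> 0 <= a.
Proof.
move=> h; rewrite leNgt; apply/negP => a0.
have [b0|b0] := leP b 0.
  by have := h 1 ltr01 (lexx _); rewrite expr1n !mul1r; lra.
pose t := Num.min 1 (- a / (2 * b)).
have t0 : 0 < t by rewrite lt_min ltr01 divr_gt0 //; lra.
have t1 : t <= 1 by rewrite ge_min lexx.
have tb : t * b <= - a / 2.
  have -> : - a / 2 = - a / (2 * b) * b by field; lra.
  by rewrite ler_pM2r // ge_min lexx orbT.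
have := h t t0 t1; rewrite expr2 -mulrA -mulrDr pmulr_rge0 //; lra.
Qed.

(** The point of least norm in the convex hull of the rows [z i] decides. If it is zero, its weights
    serve as [p]; otherwise it serves as [w], because moving towards any row cannot shorten it. *)
Lemma gordan (R : realType) (I J : finType) (z : I -> J -> R) :
  (exists w : J -> R, forall i, 0 < \sum_j w j * z i j) \/
  (exists p : I -> R, [/\ forall i, 0 <= p i, \sum_i p i = 1 &
     forall j, \sum_i p i * z i j = 0]).
Proof.
have [[i0 _]|noI] := pselect (exists i : I, True); last first.
  by left; exists (fun=> 0) => i; case: noI; exists i.
pose W : set 'rV[R]_#|I| :=
  [set v | forall k, `[0, 1]%classic (v ord0 k)] `&` [set v | \sum_k v ord0 k = 1].
have e_W i : W (delta_mx ord0 (enum_rank i)).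
  split=> /= [k|].
    by rewrite mxE /= in_itv /=; case: (_ == _); rewrite /= ?lexx ?ler01.
  rewrite (bigD1 (enum_rank i)) //= mxE !eqxx /= big1 ?addr0 // => k /negbTE ki.
  by rewrite mxE eqxx /= ki.
have cW : compact W.
  have cB := @rV_compact R #|I| (fun=> `[0, 1]%classic) (fun=> @segment_compact _ 0 1).
  apply: (subclosed_compact _ cB); last by move=> v [].
  apply: closedI; first exact: compact_closed.
  apply: (@preimage_closed _ _ (fun v : 'rV[R]_#|I| => \sum_k v ord0 k)
            [set 1 : R]); last exact: closed_eq.
  by move=> v _; apply: continuous_sum => k; exact: coord_continuous.
pose c (v : 'rV[R]_#|I|) j := \sum_k v ord0 k * z (enum_val k) j.
pose f v := \sum_j c v j * c v j.
have cf : continuous f.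
  apply: continuous_sum => j v.
  have cc : {for v, continuous (c ^~ j)}.
    apply: continuous_sum => k u; apply: continuousM; [exact: coord_continuous|exact: cst_continuous].
  exact: continuousM.
have [v] := EVT_min_rV (ex_intro _ _ (e_W i0)) cW (continuous_subspaceT cf).
rewrite inE => -[v01 v1] vmin.
have [/eqP fv0|fv0] := boolP (f v == 0).
  right; exists (fun i => v ord0 (enum_rank i)); split.
  - by move=> i; have /= := v01 (enum_rank i); rewrite in_itv /= => /andP[].
  - rewrite -v1 (reindex_onto enum_rank enum_val) /=; last by move=> k _; rewrite enum_valK.
    by apply: eq_bigl => i; rewrite enum_rankK eqxx.
  - move=> j; have : c v j * c v j = 0.
      have /eqP := fv0; rewrite psumr_eq0; last by move=> k _; rewrite -expr2 sqr_ge0.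
      by move=> /allP/(_ j)/(_ (mem_index_enum _))/implyP/(_ isT)/eqP.
    move=> /eqP; rewrite mulf_eq0 orbb => /eqP cvj; rewrite -[RHS]cvj.
    rewrite /c (reindex_onto enum_rank enum_val) /=; last by move=> k _; rewrite enum_valK.
    by apply: eq_big => [i|i _]; rewrite enum_rankK ?eqxx.
left; exists (c v) => i.
have fv_gt0 : 0 < f v.
  by rewrite lt_neqAle eq_sym fv0 sumr_ge0 // => j _; rewrite -expr2 sqr_ge0.
(* On the segment from [v] to a vertex, [f] is quadratic in [t], and its linear coefficient is
   nonnegative at the minimizer. *)
suff : 0 <= 2 * (\sum_j c v j * z i j - f v) by lra.
apply: (@min_of_quadratic_ge0 _ _ (\sum_j (z i j - c v j) ^+ 2)) => t t0 t1.
pose u := v + t *: (delta_mx ord0 (enum_rank i) - v).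
have uW : W u.
  split=> /= [k|].
    rewrite !mxE /=; have := v01 k; have [+ _] := e_W i; move=> /(_ k).
    rewrite /= mxE /= !in_itv /= => /andP[a0 a1] /andP[b0 b1].
    by apply/andP; split; nra.
  transitivity (\sum_k (v ord0 k * (1 - t) + t * delta_mx (ord0 : 'I_1) (enum_rank i) (ord0 : 'I_1) k)).
    by apply: eq_bigr => k _; rewrite !mxE; ring.
  have [_ /= e1] := e_W i.
  by rewrite big_split /= -mulr_suml -mulr_sumr e1 v1; ring.
have cu j : c u j = c v j + t * (z i j - c v j).
  have -> : z i j = c (delta_mx ord0 (enum_rank i)) j.
    rewrite /c (bigD1 (enum_rank i)) //= mxE !eqxx mul1r enum_rankK big1 ?addr0 // => k /negbTE ki.
    by rewrite mxE eqxx /= ki mul0r.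
  rewrite /c mulrBr !mulr_sumr -sumrB -big_split; apply: eq_bigr => k _ /=.
  by rewrite !mxE; ring.
have := vmin u; rewrite inE => /(_ uW).
rewrite -subr_ge0; congr (0 <= _).
rewrite /f -!sumrB !mulr_sumr -big_split; apply: eq_bigr => j _ /=; rewrite cu; ring.
Qed.

(** * Dot product and convex combinations *)

Definition dot (R : nzRingType) d (u v : 'rV[R]_d) : R :=
  \sum_j u ord0 j * v ord0 j.

Section Dot.
Variables (R : realType) (d : nat).
Implicit Types u v w : 'rV[R]_d.

Lemma dotC u v : dot u v = dot v u.
Proof. by apply: eq_bigr => j _; rewrite mulrC. Qed.

Lemma dotDr u v w : dot u (v + w) = dot u v + dot u w.
Proof. by rewrite -big_split; apply: eq_bigr => j _ /=; rewrite mxE mulrDr. Qed.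

Lemma dotZr u k v : dot u (k *: v) = k * dot u v.
Proof. by rewrite /dot mulr_sumr; apply: eq_bigr => j _; rewrite mxE; ring. Qed.

Lemma dotNr u v : dot u (- v) = - dot u v.
Proof. by rewrite -scaleN1r dotZr mulN1r. Qed.

Lemma dotBr u v w : dot u (v - w) = dot u v - dot u w.
Proof. by rewrite dotDr dotNr. Qed.

Lemma dotDl u v w : dot (u + v) w = dot u w + dot v w.
Proof. by rewrite ![dot _ w]dotC dotDr. Qed.

Lemma dotBl u v w : dot (u - v) w = dot u w - dot v w.
Proof. by rewrite ![dot _ w]dotC dotBr. Qed.

Lemma dotZl k u v : dot (k *: u) v = k * dot u v.
Proof. by rewrite ![dot _ v]dotC dotZr. Qed.

Lemma dot0l v : dot 0 v = 0.
Proof. by rewrite /dot big1 // => j _; rewrite mxE mul0r. Qed.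

Lemma dot_suml (I : Type) (r : seq I) (P : pred I) (F : I -> 'rV[R]_d) v :
  dot (\sum_(i <- r | P i) F i) v = \sum_(i <- r | P i) dot (F i) v.
Proof.
exact: (big_morph (fun u => dot u v) (fun x y => dotDl x y v) (dot0l v)).
Qed.

Lemma dot_ge0 u : 0 <= dot u u.
Proof. by apply: sumr_ge0 => j _; rewrite -expr2 sqr_ge0. Qed.

Lemma dot_eq0 u : dot u u = 0 -> u = 0.
Proof.
move=> /eqP; rewrite psumr_eq0 => [|j _]; last by rewrite -expr2 sqr_ge0.
move=> /allP u0; apply/rowP => j; rewrite mxE.
by have := u0 j (mem_index_enum _); rewrite mulf_eq0 orbb => /eqP.
Qed.

Lemma continuous_dot u : continuous (dot u).
Proof.
apply: continuous_sum => j v.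
by apply: continuousM; [exact: cst_continuous|exact: coord_continuous].
Qed.

Lemma continuous_sqnorm : continuous (fun u => dot u u).
Proof.
apply: continuous_sum => j v.
by apply: continuousM; exact: coord_continuous.
Qed.

Lemma convex_subset_conv (C : set 'rV[R]_d) x y t : convex_subset C ->
  C x -> C y -> 0 <= t -> t <= 1 -> C (t *: x + (1 - t) *: y).
Proof.
move=> cC Cx Cy t0 t1.
have tI : Itv.spec (@Itv.num_sem R) (Itv.Real `[0%Z, 1%Z]) t.
  by rewrite /Itv.spec /Itv.num_sem /= num_real in_itv /= t0 t1.
have := cC x y (Itv.mk tI); rewrite !inE; exact.
Qed.

Lemma convex_subset_sum (I : finType) (C : set 'rV[R]_d) (p : I -> R)
    (X : I -> 'rV[R]_d) :
  convex_subset C -> (forall i, 0 <= p i) -> \sum_i p i = 1 ->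
  (forall i, C (X i)) -> C (\sum_i p i *: X i).
Proof.
move=> cC p0 p1 CX.
suff H (s : seq I) : 0 < \sum_(i <- s) p i ->
    C ((\sum_(i <- s) p i)^-1 *: \sum_(i <- s) p i *: X i).
  by have := H (index_enum I); rewrite p1 invr1 scale1r; apply.
elim: s => [|i s IH]; first by rewrite big_nil ltxx.
rewrite !big_cons; set m := \sum_(i <- s) p i in IH *.
have m0 : 0 <= m by apply: sumr_ge0.
have [m_le0|m_gt0] := leP m 0.
  have mE : m = 0 by apply/eqP; rewrite eq_le m_le0.
  have -> : \sum_(j <- s) p j *: X j = 0.
    rewrite big_seq big1 // => j js; have /eqP := mE.
    rewrite psumr_eq0 // => /allP/(_ j js)/implyP/(_ isT)/eqP ->.
    by rewrite scale0r.
  by rewrite mE !addr0 => pi; rewrite scalerA mulVf ?scale1r ?gt_eqF.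
move=> pim; set y := \sum_(j <- s) p j *: X j in IH *.
have -> : (p i + m)^-1 *: (p i *: X i + y) =
    (p i / (p i + m)) *: X i + (1 - p i / (p i + m)) *: (m^-1 *: y).
  rewrite scalerDr !scalerA [p i / _]mulrC; congr (_ + _ *: _).
  by field; rewrite !gt_eqF.
apply: convex_subset_conv => //; first exact: IH.
- by rewrite divr_ge0 // ltW.
- by rewrite ler_pdivrMr // mul1r lerDl.
Qed.

End Dot.

(** * Half-spaces certifying an empty intersection *)

(** Summing [b v <= dot (u v) x] over [G] shows that these half-spaces have no common point. They
    come from [gordan] on the choices of one listed point in each set of [G]: its other alternative
    averages the choices to a common point of the sets. *)
Lemma nonface_separation (R : realType) d (V K : finType)
    (S : V -> set 'rV[R]_d) (M : V -> {set K}) (X : K -> 'rV[R]_d)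
    (G : {set V}) :
  (forall v, convex_subset (S v)) ->
  (forall v g, g \in M v -> S v (X g)) ->
  ~ (exists x, forall v, v \in G -> S v x) ->
  exists u : V -> 'rV[R]_d, exists b : V -> R,
    [/\ forall v g, v \in G -> g \in M v -> b v <= dot (u v) (X g),
        \sum_(v in G) u v = 0 & 0 < \sum_(v in G) b v].
Proof.
move=> cS SX GS.
have [/existsP[v1 /andP[v1G /eqP Mv1]]|/existsPn Mn0] :=
    boolP [exists v, (v \in G) && (M v == finset.set0)].
  (* A set with no listed point may get the empty half-space [1 <= 0]. *)
  exists (fun=> 0), (fun v => (v == v1)%:R); split.
  - move=> v g _ gM; rewrite dot0l; case: eqVneq gM => // ->.
    by rewrite Mv1 finset.inE.
  - by rewrite big1.
  - rewrite (bigD1 v1) //= eqxx big1 ?addr0 ?ltr01 // => v /andP[_ /negbTE ->] //.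
have Mne v : v \in G -> exists g, g \in M v.
  by move=> vG; apply/set0Pn; have := Mn0 v; rewrite vG.
have [v0 v0G] : exists v0, v0 \in G.
  apply/set0Pn/negP => /eqP G0; apply: GS; exists 0 => v.
  by rewrite G0 finset.inE.
pose I := {g : {ffun V -> K} | [forall v in G, g v \in M v]}.
have gM (g : I) v : v \in G -> val g v \in M v.
  by move=> vG; have /forallP/(_ v)/implyP/(_ vG) := valP g.
have [|] := gordan (fun (g : I) (k : V * 'I_d) =>
    if k.1 \in G then X (val g k.1) ord0 k.2 - X (val g v0) ord0 k.2 else 0).
- (* The weights on the differences [X (g v) - X (g v0)] become normals with sum
     zero once [v0] receives minus their total. *)
  case=> w wz.
  pose u' v := \row_j w (v, j) : 'rV[R]_d.
  pose u v := if v == v0 then u' v0 - \sum_(v in G) u' v else u' v.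
  have uE (g : I) : 0 < \sum_(v in G) dot (u v) (X (val g v)).
    suff <- : \sum_(k : V * 'I_d) w k *
        (if k.1 \in G then X (val g k.1) ord0 k.2 - X (val g v0) ord0 k.2 else 0) =
        \sum_(v in G) dot (u v) (X (val g v)) by exact: wz.
    transitivity (\sum_(v in G) dot (u' v) (X (val g v) - X (val g v0))).
      transitivity (\sum_v \sum_j w (v, j) *
          (if v \in G then X (val g v) ord0 j - X (val g v0) ord0 j else 0)).
        by rewrite pair_bigA; apply: eq_bigr => -[v j] _.
      rewrite [RHS]big_mkcond; apply: eq_bigr => v _; case: ifP => vG; last first.
        by rewrite big1 // => j _; rewrite mulr0.
      by apply: eq_bigr => j _; rewrite !mxE.
    under eq_bigr do rewrite dotBr.
    rewrite sumrB -dot_suml (bigD1 v0) //= [RHS](bigD1 v0) //= {1}/u eqxx dotBl.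
    rewrite addrAC; congr (_ + _); apply: eq_bigr => v /andP[_ /negbTE vv0].
    by rewrite /u vv0.
  (* The level of [v] is the minimum of [dot (u v)] over its listed points; the minimizers form one
     choice, so the levels have positive sum. *)
  have [v|gm gmP] := @choice _ _ (fun v k => v \in G -> k \in M v /\
      forall g, g \in M v -> dot (u v) (X k) <= dot (u v) (X g)).
    have [vG|_] := boolP (v \in G); last first.
      by have [g _] := Mne _ v0G; exists g.
    have [g0 g0M] := Mne _ vG.
    by case: (arg_minP (fun g => dot (u v) (X g)) g0M) => g gMv gmin; exists g.
  exists u, (fun v => dot (u v) (X (gm v))); split.
  + by move=> v g vG; have [_] := gmP v vG; apply.
  + rewrite (bigD1 v0) //= {1}/u eqxx [X in u' v0 - X](bigD1 v0) //=.
    rewrite opprD addrA subrr sub0r addrC; apply/eqP; rewrite subr_eq0; apply/eqP.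
    by apply: eq_bigr => v /andP[_ /negbTE vv0]; rewrite /u vv0.
  + have gmI : [forall v in G, [ffun v => gm v] v \in M v].
      by apply/forallP => v; apply/implyP => vG; rewrite ffunE; have [] := gmP v vG.
    have := uE (exist _ [ffun v => gm v] gmI); congr (0 < _).
    by apply: eq_bigr => v _; rewrite /= ffunE.
- case=> p [p0 p1 pz]; case: GS; exists (\sum_g p g *: X (val g v0)) => v vG.
  have <- : \sum_g p g *: X (val g v) = \sum_g p g *: X (val g v0).
    apply/rowP => j; apply/eqP; rewrite -subr_eq0 !summxE -sumrB; apply/eqP.
    rewrite -[RHS](pz (v, j)); apply: eq_bigr => g _ /=.
    by rewrite vG !mxE mulrBr.
  by apply: convex_subset_sum => // g; apply: SX; exact: gM.
Qed.

(** * Hyperplanes in general position *)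

Lemma exists_between_notin (R : realFieldType) (s : seq R) (lo hi : R) :
  lo < hi -> exists2 x, lo < x < hi & x \notin s.
Proof.
move=> lohi.
suff [l [h [lol lh hhi sN]]] : exists l, exists h,
    [/\ lo <= l, l < h, h <= hi & forall x, x \in s -> ~~ (l < x < h)].
  exists ((l + h) / 2); first by lra.
  by apply/negP => /sN /negP; apply; lra.
elim: s => [|y s [l [h [lol lh hhi sN]]]]; first by exists lo, hi.
have [yl|ly] := leP y ((l + h) / 2).
  exists ((l + h) / 2), h; split; [lra|lra|done|move=> x].
  rewrite in_cons => /orP[/eqP -> |/sN]; first by lra.
  by apply: contra; lra.
exists l, ((l + h) / 2); split; [done|lra|lra|move=> x].
rewrite in_cons => /orP[/eqP -> |/sN]; first by lra.
by apply: contra; lra.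
Qed.

Lemma dot_span_eq0 (R : realType) d (X : seq 'rV[R]_d) (v z : 'rV[R]_d) :
  (forall u, u \in X -> dot u z = 0) -> v \in <<X>>%VS -> dot v z = 0.
Proof.
move=> Xz /(@coord_span _ _ _ (in_tuple X)) ->.
rewrite dot_suml big1 // => i _; rewrite dotZl Xz ?mulr0 //.
by rewrite mem_nth.
Qed.

(** Strengthened to linear independence of the vectors tight at any point: this bounds their number
    by [d] and can be kept while adding one hyperplane at a time. *)
Lemma generic_levels (R : realType) d (E : finType) (a : E -> 'rV[R]_d)
    (lo hi : E -> R) : (forall k, lo k < hi k) ->
  exists2 b : E -> R, forall k, lo k < b k < hi k &
    forall x, (#|[pred k | dot (a k) x == b k]| <= d)%N.
Proof.
move=> lohi.
suff [b bI bfree] : exists2 b : E -> R, forall k, lo k < b k < hi k &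
    forall x, free [seq a k | k <- enum E & dot (a k) x == b k].
  exists b => // x; have := bfree x; rewrite /free size_map => /eqP sz.
  have -> : #|[pred k | dot (a k) x == b k]| =
      size [seq k <- enum E | dot (a k) x == b k].
    by rewrite cardE enumT {1}/enum_mem; congr size; apply: eq_filter.
  by rewrite -sz (leq_trans (dimvS (subvf _))) // dimvf /dim /= mul1n.
elim: (enum E) (enum_uniq E) => [_|k s IH /= /andP[ks /IH[b bI bfree]]].
  exists (fun k => (lo k + hi k) / 2) => [k|x]; last by rewrite /free span_nil dimv0.
  by have := lohi k; lra.
(* [y A] solves the equations indexed by [A] if they are solvable and is arbitrary otherwise. *)
have [A|y yP] := @choice {set E} _ (fun A y =>
    (exists x, forall j, j \in A -> dot (a j) x = b j) ->
    forall j, j \in A -> dot (a j) y = b j).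
  by have [[x xP]|nA] := pselect (exists x, forall j, j \in A -> dot (a j) x = b j);
    [exists x|exists 0].
have [c cI cN] :=
  exists_between_notin [seq dot (a k) (y A) | A : {set E}] (lohi k).
exists (fun j => if j == k then c else b j) => [j|x]; first by case: (eqVneq j k) => // ->.
have -> : [seq j <- s | dot (a j) x == (if j == k then c else b j)] =
    [seq j <- s | dot (a j) x == b j].
  by apply: eq_in_filter => j js; case: (eqVneq j k) js ks => // -> ->.
rewrite eqxx; case: eqP => //= kc; rewrite free_cons bfree andbT.
(* Were [a k] spanned by the earlier tight vectors, [dot (a k)] would be constant
   on the points where these are tight, and its value there was avoided. *)
apply: contra cN => kspan.
pose A := [set j in s | dot (a j) x == b j]%SET.
have xA j : j \in A -> dot (a j) x = b j by rewrite finset.inE => /andP[_ /eqP].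
have yA := yP A (ex_intro _ x xA).
apply/fintype.imageP; exists A => //; rewrite -kc; apply/eqP; rewrite -subr_eq0 -dotBr.
apply/eqP/(dot_span_eq0 _ kspan) => _ /mapP[j + ->]; rewrite mem_filter => /andP[jx js].
have jA : j \in A by rewrite finset.inE js.
by rewrite dotBr xA // yA // subrr.
Qed.

(* For every empty intersection choose half-spaces witnessing it, and relax them
   by generic small amounts; [Q v] is the intersection of the half-spaces of [S v]. *)
Lemma general_position (R : realType) d (V : finType) (S : V -> set 'rV[R]_d) :
  (forall v, convex_subset (S v)) ->
  exists Q : V -> set 'rV[R]_d,
    [/\ forall v, closed (Q v), forall v, convex_subset (Q v),
      forall G : {set V}, (exists x, forall v, v \in G -> S v x) <->
                          (exists x, forall v, v \in G -> Q v x) &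
      forall x, (#|[pred v | `[< Q v x /\ ~ (Q v)° x >]]| <= d)%N].
Proof.
move=> cS.
pose face G := exists x, forall v, v \in (G : {set V}) -> S v x.
have [G|X XP] := @choice _ _ (fun G x => face G -> forall v, v \in G -> S v x).
  by have [[x xP]|nG] := pselect (face G); [exists x|exists 0].
pose M v := [set G : {set V} | (v \in G) && `[< face G >]]%SET.
have SX v G : G \in M v -> S v (X G).
  by rewrite finset.inE => /andP[vG /asboolP /XP]; apply.
have [G|u uP] := @choice {set V} ((V -> 'rV[R]_d) * (V -> R))
  (fun G w => ~ face G ->
  [/\ forall v g, v \in G -> g \in M v -> w.2 v <= dot (w.1 v) (X g),
      \sum_(v in G) w.1 v = 0 & 0 < \sum_(v in G) w.2 v]).
  have [fG|nG] := pselect (face G); first by exists (fun=> 0, fun=> 0).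
  by have [u [b ubP]] := nonface_separation cS SX nG; exists (u, b).
(* Only an empty intersection paired with one of its members carries a constraint. Other pairs get
   normal zero and a negative level, an inequality that is strict everywhere. *)
pose bad (k : {set V} * V) := (k.2 \in k.1) && ~~ `[< face k.1 >].
pose a k := if bad k then (u k.1).1 k.2 else 0.
pose hi k := if bad k then (u k.1).2 k.2 else 0.
(* Lowering each level of a family by less than this keeps their sum positive, hence the
   intersection empty. *)
pose gap k := if bad k then (\sum_(v in k.1) (u k.1).2 v) / #|k.1|.+1%:R else 1.
have gap_gt0 k : 0 < gap k.
  rewrite /gap; case: ifP => // /andP[_ /asboolPn /uP[_ _ sum_gt0]].
  by rewrite divr_gt0.
have [|b bI btight] := @generic_levels _ _ _ a (fun k => hi k - gap k) hi.
  by move=> k; rewrite gtrBl.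
pose Q v := [set x | forall G, b (G, v) <= dot (a (G, v)) x].
exists Q; split.
- move=> v; have -> : Q v = \bigcap_G (dot (a (G, v)) @^-1` [set r | b (G, v) <= r]).
    by apply/seteqP; split => x Qx G; [move=> _; exact: Qx|exact: (Qx G I)].
  apply: closed_bigI => G _; apply: preimage_closed; last exact: closed_ge.
  by move=> x _; exact: continuous_dot.
- move=> v x y l; rewrite !inE => Qx Qy G.
  change (b (G, v) <= dot (a (G, v)) (l%:num *: (x : 'rV[R]_d) + (1 - l%:num) *: (y : 'rV[R]_d))).
  rewrite dotDr !dotZr; have := Qx G; have := Qy G.
  have : 0 <= l%:num by []. have : l%:num <= 1 by [].
  by move: l%:num (dot _ _) (dot _ _) (b _) => t p q c; nra.
- move=> G; split => [fG|[x xQ]].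
    exists (X G) => v vG G'; apply: le_trans (_ : hi (G', v) <= _).
      by have /andP[_ /ltW] := bI (G', v).
    rewrite /hi /a; case: ifP => [/andP[/= vG' /asboolPn /uP[h _ _]]|_]; last by rewrite dot0l.
    by apply: h => //; rewrite finset.inE vG; apply/asboolP.
  apply: contrapT => nG; have [_ u0 sum_gt0] := uP _ nG.
  have badG v : v \in G -> bad (G, v) by move=> vG; rewrite /bad vG; apply/asboolPn.
  have : \sum_(v in G) ((u G).2 v - gap (G, v)) <= 0.
    apply: (@le_trans _ _ (\sum_(v in G) dot ((u G).1 v) x)); last first.
      by rewrite -dot_suml u0 dot0l.
    apply: ler_sum => v vG.
    have := xQ v vG G; rewrite /a badG // => /(le_trans _); apply.
    by have /andP[/ltW + _] := bI (G, v); rewrite /hi badG.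
  rewrite leNgt => /negP; apply; rewrite sumrB subr_gt0.
  under eq_bigr => v vG do rewrite /gap badG //=.
  rewrite sumr_const -[X in X < _]mulr_natr -mulrA gtr_pMr // mulrC ltr_pdivrMr //.
  by rewrite mul1r ltr_nat.
- move=> x; apply: leq_trans (btight x).
  apply: leq_trans (leq_imset_card (fun k : {set V} * V => k.2) _).
  apply/subset_leq_card/fintype.subsetP => v /asboolP[Qx nix].
  (* If the finitely many inequalities of [Q v] were all strict at [x], then [x] would be interior
     by continuity. *)
  have [G] : exists G, dot (a (G, v)) x = b (G, v).
    apply: contrapT => nG; apply: nix.
    have nbQ G : \forall y \near x, b (G, v) <= dot (a (G, v)) y.
      apply: (cvgr_ge _ (@continuous_dot _ _ (a (G, v)) x)).
      by rewrite lt_neqAle Qx andbT; apply/eqP => e; apply: nG; exists G.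
    exact: (filter_forall _ nbQ).
  move=> e; apply: (imset_f (fun k : {set V} * V => k.2) (x := (G, v))).
  by rewrite inE /= e.
Qed.

(** * Points of least norm *)

Definition is_min_norm (R : realType) d (A : set 'rV[R]_d) x :=
  A x /\ forall y, A y -> dot x x <= dot y y.

Lemma exists_min_norm (R : realType) d (A : set 'rV[R]_d) :
  closed A -> A !=set0 -> exists x, is_min_norm A x.
Proof.
move=> clA [a Aa]; pose r := dot a a.
pose B := A `&` [set y | dot y y <= r].
have cB : compact B.
  (* A coordinate whose square is at most [r] is bounded by [r + 1], which avoids a square root. *)
  have cbox := @rV_compact R d (fun=> `[- (r + 1), r + 1]%classic)
    (fun=> @segment_compact _ (- (r + 1)) (r + 1)).
  apply: (subclosed_compact _ cbox).
    apply: closedI => //.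
    apply: (@preimage_closed _ _ (fun y : 'rV[R]_d => dot y y) [set z | z <= r]).
      by move=> y _; exact: continuous_sqnorm.
    exact: closed_le.
  move=> y [_ /= yr] j; rewrite /= in_itv /=.
  have : y ord0 j * y ord0 j <= r.
    apply: le_trans yr; rewrite /dot (bigD1 j) //= lerDl.
    by apply: sumr_ge0 => i _; rewrite -expr2 sqr_ge0.
  by move=> yjr; apply/andP; split; nra.
have Ba : B a by split => //=.
have [x] := EVT_min_rV (ex_intro _ _ Ba) cB (continuous_subspaceT (@continuous_sqnorm R d)).
rewrite inE => -[Ax xr] xmin; exists x; split=> // y Ay.
have [yr|ry] := leP (dot y y) r; last exact: le_trans xr (ltW ry).
by apply: xmin; rewrite inE; split.
Qed.

Lemma sqnorm_conv (R : realType) d (x y : 'rV[R]_d) t :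
  dot (t *: y + (1 - t) *: x) (t *: y + (1 - t) *: x) =
  t * dot y y + (1 - t) * dot x x - t * (1 - t) * dot (y - x) (y - x).
Proof. by rewrite !dotBr !dotBl !dotDr !dotDl !dotZr !dotZl; ring. Qed.

(** Otherwise the midpoint of [x] and [y] would be shorter than [x]. *)
Lemma min_norm_unique (R : realType) d (A : set 'rV[R]_d) x y :
  convex_subset A -> is_min_norm A x -> A y -> dot y y <= dot x x -> y = x.
Proof.
move=> cA [Ax xmin] Ay yx; apply/eqP; rewrite -subr_eq0; apply/eqP/dot_eq0.
apply/eqP; rewrite eq_le dot_ge0 andbT.
have half0 : 0 <= 2^-1 :> R by lra.
have half1 : 2^-1 <= 1 :> R by lra.
have := xmin _ (convex_subset_conv cA Ay Ax half0 half1).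
by rewrite sqnorm_conv; lra.
Qed.

(** Given a shorter point [y] of the larger intersection, a small step from [x] towards [y] stays in
    the dropped sets, as [x] is interior to them, and in the kept ones by convexity; it shortens
    [x]. *)
Lemma min_norm_drop_interior (R : realType) d (J : finType) (I : {set J})
    (Q : J -> set 'rV[R]_d) x :
  (forall i, i \in I -> convex_subset (Q i)) ->
  is_min_norm [set y | forall i, i \in I -> Q i y] x ->
  is_min_norm [set y | forall i, i \in I -> ~ (Q i)° x -> Q i y] x.
Proof.
move=> cQ [Qx xmin]; split=> [i iI _|y Qy]; first exact: Qx.
rewrite leNgt; apply/negP => yx.
pose f (t : R) := t *: y + (1 - t) *: x.
have cf : continuous (fun t : R => t *: y + (1 - t) *: x).
  move=> t.
  apply: (@continuousD _ 'rV[R]_d R^o (fun t : R => t *: y) (fun t : R => (1 - t) *: x)).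
    by apply: continuousZr_tmp; exact: cvg_id.
  apply: continuousZr_tmp; apply: continuousB; first exact: cst_continuous.
  exact: cvg_id.
have near_Q (i : J) : \forall t \near (0 : R), i \in I -> (Q i)° x -> Q i (f t).
  have [ix|nix] := pselect ((Q i)° x); last first.
    exact: (@filterE _ (nbhs (0 : R)) _ _ (fun t _ ix => False_ind _ (nix ix))).
  have /(cf 0) : nbhs (0 *: y + (1 - 0) *: x) (Q i).
    by rewrite scale0r add0r subr0 scale1r.
  exact: (@filterS _ (nbhs (0 : R)) _ _ _ (fun t Qt _ _ => Qt)).
have /nbhs_ballP[e /= e0 eP] :
    \forall t \near (0 : R), forall i, i \in I -> (Q i)° x -> Q i (f t).
  exact: (@filter_forall _ _ _ (nbhs (0 : R)) _ near_Q).
pose t := Num.min (e / 2) 1.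
have t0 : 0 < t by rewrite lt_min ltr01 andbT divr_gt0.
have t1 : t <= 1 by rewrite ge_min lexx orbT.
have te : t < e by apply: le_lt_trans (_ : e / 2 < e); rewrite ?ge_min ?lexx //; lra.
have Qt i : i \in I -> Q i (f t).
  move=> iI; have [ix|nix] := pselect ((Q i)° x).
    by apply: eP => //; rewrite /ball /= sub0r normrN gtr0_norm.
  by apply: convex_subset_conv; [exact: cQ|exact: Qy|exact: Qx|exact: ltW|].
have := xmin _ Qt; rewrite /f sqnorm_conv => h.
have : 0 <= t * (1 - t) * dot (y - x) (y - x).
  by rewrite !mulr_ge0 ?dot_ge0 ?subr_ge0 // ltW.
nra.
Qed.

(** * Ranks and minimizers in the sweep *)

Section Sweep.
Variables (R : realType) (d n : nat).
Local Notation pt := 'rV[R]_d.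
Variables (F : 'I_n -> set (set pt)) (q : 'I_n -> set pt -> set pt).
Variable vs : seq R.
Implicit Types (C D K : 'I_n -> set pt) (I J : {set 'I_n}) (x y : pt) (k : nat).

Definition selection C := forall i, F i (C i).
Definition thick_inter I C := [set x | forall i, i \in I -> q i (C i) x].
Definition tight C x := [set i | `[< q i (C i) x /\ ~ (q i (C i))° x >]]%SET.

Hypothesis thick_closed : forall i A, F i A -> closed (q i A).
Hypothesis thick_convex : forall i A, F i A -> convex_subset (q i A).
Hypothesis thick_miss : forall i x, exists2 A, F i A & ~ q i A x.
Hypothesis card_tight : forall C x, selection C -> (#|tight C x| <= d)%N.
Hypothesis min_norm_vs : forall C I x, selection C ->
  is_min_norm (thick_inter I C) x -> dot x x \in vs.
Hypothesis dn : (d + 2 <= n)%N.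

(** A discrete radius: by [min_norm_vs], least-norm points of different norms have different
    ranks. *)
Definition rk x := count (fun w => w < dot x x) vs.
Definition above k I C := forall x, thick_inter I C x -> (k <= rk x)%N.
Definition update C j A := fun i => if i == j then A else C i.
(** The part common to both tuples is above level [k]; by [above_sub] so are both ends. The ends may
    coincide. *)
Definition sweep_edge k C D := [/\ selection C, selection D &
  exists j, (forall i, i != j -> C i = D i) /\ above k (~: [set j])%SET C].
Definition sweep_path k := clos_refl_trans _ (sweep_edge k).

Lemma thick_inter_agree I C D :
  (forall i, i \in I -> C i = D i) -> thick_inter I C = thick_inter I D.
Proof.
by move=> CD; apply/seteqP; split => x Qx i iI; have := Qx i iI; rewrite CD.
Qed.

Lemma thick_inter_sub I J C : I \subset J -> thick_inter J C `<=` thick_inter I C.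
Proof. by move=> /fintype.subsetP IJ x Qx i /IJ; exact: Qx. Qed.

Lemma above_sub k I J C : I \subset J -> above k I C -> above k J C.
Proof. by move=> IJ abI x /(thick_inter_sub IJ) /abI. Qed.

Lemma above_agree k I C D :
  (forall i, i \in I -> C i = D i) -> above k I C -> above k I D.
Proof. by rewrite /above => /thick_inter_agree ->. Qed.

Lemma thick_inter_convex I C : selection C -> convex_subset (thick_inter I C).
Proof.
move=> sC x y l; rewrite !inE => Qx Qy i iI.
by have := thick_convex (sC i) (x := x) (y := y) l; rewrite !inE; apply; [exact: Qx|exact: Qy].
Qed.

Lemma exists_thick_min I C x : selection C -> thick_inter I C x ->
  exists2 m, is_min_norm (thick_inter I C) m & (rk m <= rk x)%N.
Proof.
move=> sC Qx; have clQ : closed (thick_inter I C).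
  have -> : thick_inter I C = \bigcap_(i in [set i | i \in I]) q i (C i).
    by apply/seteqP; split.
  by apply: closed_bigI => i _; exact: thick_closed.
have [m mmin] := exists_min_norm clQ (ex_intro _ x Qx).
exists m => //; apply: sub_count => w /= /lt_le_trans; apply.
by have [_] := mmin; apply.
Qed.

Lemma rk_lt x y : dot x x \in vs -> dot x x < dot y y -> (rk x < rk y)%N.
Proof.
move=> xvs xy; rewrite /rk; elim: vs xvs => //= w s IH.
have sub : (count (fun w => (w < dot x x)%R) s <= count (fun w => (w < dot y y)%R) s)%N.
  by apply: sub_count => v /= /lt_trans; apply.
rewrite in_cons => /orP[/eqP <-|/IH lt_s]; first by rewrite ltxx xy add0n add1n ltnS.
apply: (@leq_ltn_trans ((w < dot y y)%R + count (fun w => (w < dot x x)%R) s)%N).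
  by rewrite leq_add2r; case: (ltP w (dot x x)) => // /lt_trans/(_ xy) ->.
by rewrite ltn_add2l.
Qed.

(* A family extending [C] on [I] that is not pushed above level [k] must have the
   same minimizer: its own minimizer lies in the intersection for [C] and cannot
   have a smaller norm. *)
Lemma below_mem k I J C D x : selection C -> selection D ->
  is_min_norm (thick_inter I C) x -> rk x = k ->
  (forall i, i \in I -> C i = D i) -> I \subset J ->
  ~ above k.+1 J D -> thick_inter J D x.
Proof.
move=> sC sD xmin xk CD IJ /existsNP[y /not_implyP[Qy /negP]].
rewrite -ltnNge ltnS => yk.
have [m mmin my] := exists_thick_min sD Qy.
have mI : thick_inter I C m.
  by rewrite (thick_inter_agree CD); apply: thick_inter_sub IJ _ (proj1 mmin).
suff <- : m = x by exact: (proj1 mmin).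
apply: (min_norm_unique (thick_inter_convex (I := I) sC) xmin mI).
rewrite leNgt; apply/negP => /(rk_lt (min_norm_vs sC xmin)).
by rewrite xk ltnNge (leq_trans my yk).
Qed.

Lemma above_miss k I J C D x i : selection C -> selection D ->
  is_min_norm (thick_inter I C) x -> rk x = k ->
  (forall i, i \in I -> C i = D i) -> I \subset J ->
  i \in J -> ~ q i (D i) x -> above k.+1 J D.
Proof.
move=> sC sD xmin xk CD IJ iJ Dix; apply: contrapT => nab.
exact: Dix (below_mem sC sD xmin xk CD IJ nab iJ).
Qed.

Lemma exists_min_at k I C : selection C -> above k I C -> ~ above k.+1 I C ->
  exists2 x, is_min_norm (thick_inter I C) x & rk x = k.
Proof.
move=> sC ab /existsNP[y /not_implyP[Qy /negP]]; rewrite -ltnNge ltnS => yk.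
have [m mmin my] := exists_thick_min sC Qy; exists m => //.
by apply/eqP; rewrite eqn_leq (leq_trans my yk) ab //; case: mmin.
Qed.

Lemma min_tight I C x : selection C -> is_min_norm (thick_inter I C) x ->
  is_min_norm (thick_inter (I :&: tight C x) C) x.
Proof.
move=> sC xmin.
have [|_ xle] := min_norm_drop_interior (I := I) (Q := fun i => q i (C i)) _ xmin.
  by move=> i _; exact: thick_convex.
split=> [i|y Qy]; first by rewrite finset.inE => /andP[iI _]; exact: (proj1 xmin).
apply: xle => i iI nix; apply: Qy; rewrite !finset.inE iI /=.
by apply/asboolP; split=> //; exact: (proj1 xmin).
Qed.

(** * Paths inside a level and lifts to the next one *)

Lemma update_selection C j A : selection C -> F j A -> selection (update C j A).
Proof. by move=> sC FA i; rewrite /update; case: eqP => // ->. Qed.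

(** Coordinates outside [J] change one at a time, while the sets on [J] stay and keep every move
    above level [k]. *)
Lemma sweep_path_agree k J C D : selection C -> selection D ->
  (forall i, i \in J -> C i = D i) -> above k J C -> sweep_path k C D.
Proof.
move=> sC sD CD ab.
pose mix (s : seq 'I_n) i := if i \in s then D i else C i.
have smix s : selection (mix s) by move=> i; rewrite /mix; case: ifP.
suff path_mix s : sweep_path k C (mix s).
  have -> : D = mix (enum 'I_n) by apply/funext => i; rewrite /mix mem_enum.
  exact: path_mix.
elim: s => [|j s IH]; first by rewrite /mix; exact: rt_refl.
apply: rt_trans IH _; have [jJ|jJ] := boolP (j \in J).
  suff -> : mix (j :: s) = mix s by exact: rt_refl.
  apply/funext => i; rewrite /mix in_cons; case: eqP => //= ->.
  by rewrite CD //; case: ifP.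
apply: rt_step; split=> //; exists j; split=> [i /negbTE ij|].
  by rewrite /mix in_cons ij.
apply: (@above_sub _ J).
  by apply/fintype.subsetP => i iJ; rewrite !finset.inE; apply: contraNneq jJ => <-.
by apply: above_agree ab => i iJ; rewrite /mix CD //; case: ifP.
Qed.

(* Once some set outside [I] misses [x], every other coordinate outside [I] moves
   freely above level [k]; two free coordinates allow the detour from [C] to [D]. *)
Lemma star_connected k I C0 C D x i j : selection C0 -> selection C -> selection D ->
  is_min_norm (thick_inter I C0) x -> rk x = k -> (#|I| + 2 <= n)%N ->
  (forall i, i \in I -> C0 i = C i) -> (forall i, i \in I -> C0 i = D i) ->
  i \notin I -> j \notin I -> ~ q i (C i) x -> ~ q j (D j) x ->
  sweep_path k.+1 C D.
Proof.
move=> sC0 sC sD xmin xk cI.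
have distinct C' D' i' j' : selection C' -> selection D' -> i' != j' ->
    (forall i, i \in I -> C0 i = C' i) -> (forall i, i \in I -> C0 i = D' i) ->
    i' \notin I -> j' \notin I -> ~ q i' (C' i') x -> ~ q j' (D' j') x ->
    sweep_path k.+1 C' D'.
  move=> sC' sD' ij IC ID iI jI Ci Dj.
  have sE := update_selection sC' (sD' j').
  have IE l : l \in I -> C0 l = update C' j' (D' j') l.
    by move=> lI; rewrite /update IC //; case: eqP lI jI => // -> ->.
  (* Placing [D' j'] is allowed while coordinate [i'] misses [x]; afterwards [j'] misses [x] and the
     other coordinates outside [I] are free. *)
  apply: (@rt_trans _ _ _ (update C' j' (D' j'))).
    apply: rt_step; split=> //; exists j'; split=> [l /negbTE lj|].
      by rewrite /update lj.
    apply: (above_miss sC0 sC' xmin xk IC _ _ Ci); last by rewrite !finset.inE.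
    by apply/fintype.subsetP => l lI; rewrite !finset.inE; apply: contraNneq jI => <-.
  apply: (@sweep_path_agree _ (j' |: I)%SET) => //.
    move=> l; rewrite !finset.inE /update; case: eqP => [-> //|_ /= lI].
    by rewrite -IC // ID.
  apply: (above_miss (i := j') sC0 sE xmin xk IE); first exact: finset.subsetUr.
    by rewrite !finset.inE eqxx.
  by rewrite /update eqxx.
move=> IC ID iI jI Ci Dj; have [ij|ij] := eqVneq i j; last exact: (distinct _ _ i j).
(* When [i] and [j] coincide, the bound on [#|I|] leaves another coordinate [l], where a set missing
   [x] gives an intermediate stop. *)
have [l] : exists l, l \notin (i |: I)%SET.
  apply/existsP; rewrite -negb_forall; apply/negP => /forallP h.
  have : (n <= #|i |: I|)%N.
    by rewrite -{1}(card_ord n) -cardsT; apply/subset_leq_card/fintype.subsetP.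
  by rewrite cardsU1 iI => /(leq_trans cI); rewrite addnC leq_add2r.
rewrite !finset.inE negb_or => /andP[li lI].
have [A FA Ax] := thick_miss l x.
have sE := update_selection sC FA.
have IE m : m \in I -> C0 m = update C l A m.
  by move=> mI; rewrite /update IC //; case: eqP mI lI => // -> ->.
have El : ~ q l (update C l A l) x by rewrite /update eqxx.
apply: (@rt_trans _ _ _ (update C l A)).
  by apply: (distinct _ _ i l) => //; rewrite eq_sym.
by apply: (distinct _ _ l j) => //; rewrite -ij.
Qed.

(* A representative one level up: [C] itself when it is already there, and else
   [C] with one set, not tight at the minimizer, replaced by a set missing it. *)
Definition lift_to k C K :=
  (above k.+1 [set: 'I_n]%SET C /\ K = C) \/
  exists x i A, [/\ is_min_norm (thick_inter [set: 'I_n]%SET C) x, rk x = k,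
    i \notin tight C x, F i A /\ ~ q i A x & K = update C i A].

Lemma lift_to_selection k C K : selection C -> lift_to k C K -> selection K.
Proof.
by move=> sC [[_ ->] //|[x [i [A [_ _ _ [FA _] ->]]]]]; exact: update_selection.
Qed.

Lemma exists_lift k C : selection C -> above k [set: 'I_n]%SET C ->
  exists K, lift_to k C K.
Proof.
move=> sC ab; have [ab1|nab1] := pselect (above k.+1 [set: 'I_n]%SET C).
  by exists C; left.
have [x xmin xk] := exists_min_at sC ab nab1.
have [i it] : exists i, i \notin tight C x.
  apply/existsP; rewrite -negb_forall; apply/negP => /forallP h.
  have : (n <= #|tight C x|)%N.
    by rewrite -{1}(card_ord n) -cardsT; apply/subset_leq_card/fintype.subsetP.
  by move=> /leq_trans/(_ (card_tight x sC)) /(leq_trans dn); rewrite -{2}(addn0 d) leq_add2l.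
have [A FA Ax] := thick_miss i x.
by exists (update C i A); right; exists x, i, A.
Qed.

(** Brings a lift into the form that [star_connected] takes. If [C] was kept, its set at [j] misses
    [x], or [x] would be a point of rank [k] in the whole intersection. If a set was replaced, the
    minimizer for [C] is again [x]. *)
Lemma lift_to_star k j C0 C K x : selection C0 -> selection C ->
  is_min_norm (thick_inter (~: [set j])%SET C0) x -> rk x = k ->
  (forall i, i != j -> C0 i = C i) -> lift_to k C K ->
  exists i, [/\ i \notin (~: [set j] :&: tight C0 x)%SET, ~ q i (K i) x &
    forall l, l \in (~: [set j] :&: tight C0 x)%SET -> C0 l = K l].
Proof.
move=> sC0 sC xmin xk CC0 [[ab ->]|[y [i [A [ymin yk it [FA Ay] ->]]]]].
  exists j; split=> [|Cjx|l]; last 2 first.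
  - have : thick_inter [set: 'I_n]%SET C x.
      move=> i _; have [-> //|ij] := eqVneq i j.
      by rewrite -CC0 //; apply: (proj1 xmin); rewrite !finset.inE.
    by move=> /ab; rewrite xk ltnn.
  - by rewrite !finset.inE => /andP[lj _]; exact: CC0.
  by rewrite !finset.inE eqxx.
have yx : y = x.
  have nab : ~ above k.+1 [set: 'I_n]%SET C.
    by move=> /(_ y (proj1 ymin)); rewrite yk ltnn.
  have CC0' l : l \in (~: [set j])%SET -> C0 l = C l by rewrite !finset.inE; exact: CC0.
  have Qx := below_mem sC0 sC xmin xk CC0' (finset.subsetT _) nab.
  apply: (min_norm_unique (thick_inter_convex (I := _) sC0) xmin).
    rewrite (thick_inter_agree CC0').
    exact: thick_inter_sub (finset.subsetT _) _ (proj1 ymin).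
  exact: (proj2 ymin).
subst y.
(* The replaced coordinate is not tight for [C] at [x], so if it is not [j], it is not tight for
   [C0] either. *)
have iN l : l \in (~: [set j] :&: tight C0 x)%SET -> l != i.
  rewrite !finset.inE => /andP[lj lt]; apply: contraNneq it => <-.
  by rewrite finset.inE -CC0.
exists i; split.
- by apply/negP => /iN; rewrite eqxx.
- by rewrite /update eqxx.
- move=> l lI; rewrite /update (negbTE (iN l lI)); apply: CC0.
  by have := lI; rewrite !finset.inE => /andP[].
Qed.

Lemma card_setI_tight I C x : selection C -> (#|I :&: tight C x| + 2 <= n)%N.
Proof.
move=> sC; apply: leq_trans dn; rewrite leq_add2r.
exact: leq_trans (subset_leq_card (finset.subsetIr _ _)) (card_tight x sC).
Qed.

(** If the common part is above level [k.+1], the edge survives and the lifts are its ends.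
    Otherwise both lifts share the sets of the common part tight at its minimizer and miss that
    point elsewhere. *)
Lemma lift_edge k C D K L : sweep_edge k C D -> lift_to k C K -> lift_to k D L ->
  sweep_path k.+1 K L.
Proof.
move=> [sC sD [j [CD ab]]] CK DL.
have sK := lift_to_selection sC CK; have sL := lift_to_selection sD DL.
have [ab1|nab1] := pselect (above k.+1 (~: [set j])%SET C).
  have abC : above k.+1 [set: 'I_n]%SET C by apply: above_sub ab1; exact: finset.subsetT.
  have abD : above k.+1 [set: 'I_n]%SET D.
    apply: above_sub (finset.subsetT (~: [set j])%SET) _.
    by apply: above_agree ab1 => i; rewrite !finset.inE; exact: CD.
  have lift_id E M : above k.+1 [set: 'I_n]%SET E -> lift_to k E M -> M = E.
    move=> abE [[_ //]|[x [_ [_ [[Qx _] xk _ _ _]]]]].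
    by have := abE x Qx; rewrite xk ltnn.
  rewrite (lift_id _ _ abC CK) (lift_id _ _ abD DL).
  by apply: rt_step; split=> //; exists j.
have [x xmin xk] := exists_min_at sC ab nab1.
have [i [iI Kix CKI]] := lift_to_star sC sC xmin xk (fun _ _ => erefl) CK.
have [l [lI Llx CLI]] := lift_to_star sC sD xmin xk CD DL.
apply: (star_connected sC sK sL (min_tight sC xmin) xk _ CKI CLI iI lI Kix Llx).
exact: card_setI_tight.
Qed.

(** Lifts depend on the chosen coordinate and set; two proper ones share the sets tight at the
    minimizer and each misses it elsewhere. *)
Lemma lift_refl k C K L : selection C -> lift_to k C K -> lift_to k C L ->
  sweep_path k.+1 K L.
Proof.
move=> sC CK CL.
have sK := lift_to_selection sC CK; have sL := lift_to_selection sC CL.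
case: CK CL => [[ab ->]|[x [i [A [xmin xk it [FA Ax] KE]]]]].
  case=> [[_ ->]|[x [_ [_ [[Qx _] xk _ _ _]]]]]; first exact: rt_refl.
  by have := ab x Qx; rewrite xk ltnn.
case=> [[ab _]|[y [l [B [ymin yk lt [FB By] LE]]]]].
  by have := ab x (proj1 xmin); rewrite xk ltnn.
have yx : y = x.
  apply: (min_norm_unique (thick_inter_convex (I := _) sC) xmin (proj1 ymin)).
  exact: (proj2 ymin _ (proj1 xmin)).
subst y; have agree m A' j : m \notin tight C x ->
    j \in ([set: 'I_n] :&: tight C x)%SET -> update C m A' j = C j.
  move=> mt; rewrite !finset.inE /= /update => jt.
  by case: eqP jt mt => // ->; rewrite finset.inE => ->.
apply: (star_connected (i := i) (j := l) sC sK sL (min_tight sC xmin) xk).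
- exact: card_setI_tight.
- by move=> j jI; rewrite KE agree.
- by move=> j jI; rewrite LE agree.
- by rewrite finset.in_setI negb_and it orbT.
- by rewrite finset.in_setI negb_and lt orbT.
- by rewrite KE /update eqxx.
- by rewrite LE /update eqxx.
Qed.

Lemma sweep_connected k C D : selection C -> selection D ->
  above k [set: 'I_n]%SET C -> above k [set: 'I_n]%SET D -> sweep_path k C D.
Proof.
elim: k C D => [|k IH] C D sC sD abC abD.
  (* Level 0 restricts nothing, so even the empty set of coordinates is above it. *)
  by apply: (@sweep_path_agree _ finset.set0) => // i; rewrite finset.inE.
have ab_pred E : above k.+1 [set: 'I_n]%SET E -> above k [set: 'I_n]%SET E.
  by move=> abE x /abE /ltnW.
(* A path at level [k] is lifted vertex by vertex; [C] and [D], already above [k.+1], are their own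
   lifts. *)
suff lift_path E E' : sweep_path k E E' ->
    selection E -> above k [set: 'I_n]%SET E -> forall K L, lift_to k E K ->
    lift_to k E' L -> sweep_path k.+1 K L.
  by apply: (lift_path _ _ (IH C D sC sD (ab_pred _ abC) (ab_pred _ abD))) => //;
    [exact: ab_pred|left|left].
move=> /clos_rt_rt1n_iff; elim=> [E1 sE1 _ K L|E1 E2 E3 e12 _ IH2 sE1 ab1 K L EK EL].
  exact: lift_refl.
have [_ sE2 [j [E12 abj]]] := e12.
have ab2 : above k [set: 'I_n]%SET E2.
  apply: above_sub (finset.subsetT (~: [set j])%SET) _.
  by apply: above_agree abj => i; rewrite !finset.inE; exact: E12.
have [M EM] := exists_lift sE2 ab2.
exact: rt_trans (lift_edge e12 EK EM) (IH2 sE2 ab2 _ _ EM EL).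
Qed.

(** Ranks never exceed [size vs], so one level further no point is left. *)
Lemma above_top I C : above (size vs).+1 I C <-> thick_inter I C = set0.
Proof.
split=> [ab|Q0 x]; last by rewrite Q0.
by apply/seteqP; split=> // x /ab; rewrite ltnNge count_size.
Qed.

End Sweep.

(** * Thickening the families and returning to the reconfiguration graph *)

Lemma exists_thickening (R : realType) (d n : nat) (F : 'I_n -> set (set 'rV[R]_d)) :
  (forall i, finite_set (F i)) ->
  (forall i C, F i C -> convex_subset C) ->
  (forall i, \bigcap_(C in F i) C = set0) ->
  exists (q : 'I_n -> set 'rV[R]_d -> set 'rV[R]_d) (vs : seq R),
  [/\ forall i A, F i A -> closed (q i A) /\ convex_subset (q i A),
    forall i x, exists2 A, F i A & ~ q i A x,
    forall C x, selection F C -> (#|tight q C x| <= d)%N,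
    forall C I x, selection F C -> is_min_norm (thick_inter q I C) x -> dot x x \in vs &
    forall C (I : {set 'I_n}), selection F C ->
      (exists x, forall i, i \in I -> C i x) <-> thick_inter q I C !=set0].
Proof.
move=> finF cF F0.
have [i|L FL] := @choice _ _ (fun i (s : seq (set 'rV[R]_d)) => F i = [set` s]).
  exact/finite_seqP.
(* Sets are indexed together with their family, so that equal sets in different coordinates of a
   tuple count separately in the tightness bound. *)
pose s := [seq (i, A) | i <- enum 'I_n, A <- L i].
have sP i A : ((i, A) \in s) = (A \in L i).
  apply/allpairsPdep/idP => [[j [B [_ BL [-> ->]]]] //|AL].
  by exists i, A; rewrite mem_enum.
have FLP i A : F i A <-> A \in L i by rewrite FL.
pose V := seq_sub s; pose S (v : V) := (ssval v).2.
have cS v : convex_subset (S v).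
  by apply: (cF (ssval v).1); apply/FLP; rewrite -sP -surjective_pairing; exact: valP.
have [Q [clQ cQ nerveQ tightQ]] := general_position cS.
pose q i A := if insub (i, A) is Some v then Q (v : V) else setT.
have qE (v : V) : q (ssval v).1 (ssval v).2 = Q v.
  by rewrite /q -surjective_pairing valK.
have FV i A : F i A -> exists v : V, ssval v = (i, A).
  by move=> /FLP; rewrite -sP => iA; exists (SeqSub iA).
have VF (v : V) : F (ssval v).1 (ssval v).2.
  by apply/FLP; rewrite -sP -surjective_pairing; exact: valP.
have lift C : selection F C -> exists vv : 'I_n -> V, forall i, ssval (vv i) = (i, C i).
  by move=> sC; have [|vv vvP] := @choice _ _ (fun i (v : V) => ssval v = (i, C i));
    [move=> i; exact: FV|exists vv].
have qvv (C : 'I_n -> set 'rV[R]_d) (vv : 'I_n -> V) i :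
    ssval (vv i) = (i, C i) -> q i (C i) = Q (vv i).
  by move=> e; rewrite -qE e.
have interE C (vv : 'I_n -> V) (I : {set 'I_n}) : (forall i, ssval (vv i) = (i, C i)) ->
    thick_inter q I C = [set x | forall v, v \in [set vv i | i in I]%SET -> Q v x].
  move=> vvP; apply/seteqP; split => x Qx /=.
    by move=> _ /finset.imsetP[i iI ->]; rewrite -(qvv _ _ _ (vvP i)); exact: Qx.
  by move=> i iI; rewrite (qvv _ _ _ (vvP i)); apply: Qx; exact: imset_f.
have [G|m mP] := @choice {set V} _ (fun G m =>
    (exists x, is_min_norm [set x | forall v, v \in G -> Q v x] x) ->
    is_min_norm [set x | forall v, v \in G -> Q v x] m).
  by have [[x xP]|nG] := pselect (exists x,
    is_min_norm [set x | forall v, v \in G -> Q v x] x); [exists x|exists 0].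
(* Every intersection along a tuple is indexed by a subset of [V], so finitely many least norms
   occur. *)
exists q, [seq dot (m G) (m G) | G : {set V}]; split.
- by move=> i A /FV[v e]; have := qE v; rewrite e => /= ->.
- move=> i x; apply: contrapT => nA.
  (* A point in all polyhedra of family [i] would yield a common point of [F i] by the nerve
     equivalence. *)
  have xQ v : v \in [set v : V | (ssval v).1 == i]%SET -> Q v x.
    rewrite finset.inE => /eqP e; rewrite -qE e; apply: contrapT => nq.
    by apply: nA; exists (ssval v).2 => //; rewrite -e; exact: VF.
  have [y yS] := (nerveQ _).2 (ex_intro _ x xQ).
  suff : (\bigcap_(C in F i) C) y by rewrite F0.
  move=> A /FV[v e]; have := yS v; rewrite /S e /=; apply.
  by rewrite finset.inE e /=.
- move=> C x sC; have [vv vvP] := lift C sC.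
  have inj_vv : injective vv.
    by move=> i j ij; have := vvP i; rewrite ij vvP => -[].
  rewrite -(fintype.card_image inj_vv); apply: leq_trans (tightQ x).
  apply/subset_leq_card/fintype.subsetP => _ /fintype.imageP[i it ->].
  by move: it; rewrite finset.inE (qvv _ _ _ (vvP i)).
- move=> C I x sC; have [vv vvP] := lift C sC.
  rewrite (interE C vv I vvP) => xmin; apply/fintype.imageP; exists [set vv i | i in I]%SET => //.
  have mmin := mP _ (ex_intro _ x xmin).
  by apply/eqP; rewrite eq_le (proj2 xmin _ (proj1 mmin)) (proj2 mmin _ (proj1 xmin)).
- move=> C I sC; have [vv vvP] := lift C sC; rewrite (interE C vv I vvP).
  apply: iff_trans (nerveQ _); split=> -[x xP]; exists x.
    by move=> _ /finset.imsetP[i iI ->]; rewrite /S vvP; exact: xP.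
  by move=> i iI; have := xP (vv i); rewrite /S vvP; apply; exact: imset_f.
Qed.

Theorem theorem7p4 (R : realType) (d n : nat)
    (F : 'I_n -> set (set 'rV[R]_d)) :
  (forall i, finite_set (F i)) ->
  (forall i C, F i C -> convex_subset C) ->
  (forall i, \bigcap_(C in F i) C = set0) ->
  (d + 2 <= n)%N ->
  RG_connected F.
Proof.
move=> finF cF F0 dn.
have [q [vs [qF qmiss qtight qvs nerve]]] := exists_thickening finF cF F0.
(* With [I] all coordinates this describes vertices; with one coordinate removed, it gives the
   adjacency condition. *)
have topP C (I : {set 'I_n}) : selection F C ->
    above q vs (size vs).+1 I C <-> ~ exists x, forall i, i \in I -> C i x.
  move=> sC; rewrite above_top (nerve C I sC); split=> [->|/set0P/negP/negPn/eqP //].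
  by case.
have vertex_above C : RG_vertex F C -> above q vs (size vs).+1 [set: 'I_n]%SET C.
  move=> [sC C0]; apply/(topP _ _ sC) => -[x Cx].
  have : (\bigcap_i C i) x by move=> i _; apply: Cx; rewrite finset.inE.
  by rewrite C0.
have above_vertex C : selection F C -> above q vs (size vs).+1 [set: 'I_n]%SET C ->
    RG_vertex F C.
  move=> sC /(topP _ _ sC) C0; split=> //; apply/seteqP; split=> // x Cx.
  by apply: C0; exists x => i _; exact: Cx.
move=> C D vC vD.
have := sweep_connected (fun i A FA => proj1 (qF i A FA)) (fun i A FA => proj2 (qF i A FA))
  qmiss qtight qvs dn (proj1 vC) (proj1 vD) (vertex_above C vC) (vertex_above D vD).
elim=> [E E' [sE sE' [j [EE' ab]]]|E|E E' E'' _ + _]; [|exact: rt_refl|exact: rt_trans].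
(* A sweep edge may be stationary, while adjacent vertices differ at [j]. *)
have [e|ne] := pselect (E j = E' j).
  suff -> : E = E' by exact: rt_refl.
  by apply/funext => i; have [->//|/EE'] := eqVneq i j.
apply: rt_step; split; [|split].
- by apply: above_vertex => //; apply: above_sub ab; exact: finset.subsetT.
- apply: above_vertex => //; apply: above_sub (finset.subsetT (~: [set j])%SET) _.
  by apply: above_agree ab => i; rewrite !finset.inE; exact: EE'.
- exists j; split=> //; split=> [i /eqP|]; first exact: EE'.
  apply/seteqP; split=> // x Ex; apply: ((topP _ _ sE).1 ab); exists x => i.
  by rewrite !finset.inE => /eqP ij; exact: Ex.
Qed.
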